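(* Let $G$ be the $d$-dimensional grid graph with $n$ nodes, let $c\in(0,1)$ be a constant, and let $$K=\{\theta\in\mathbb{R}^n:\|\nabla_G\theta\|_1\le c\,n^{1-1/d},\ \|\theta\|_\infty\le c\}.$$ Let $\mathcal{F}:=\{\tilde v:\mathbb{R}^n\to\mathbb{R}^n\text{ measurable}\}$ be the collection of estimators. Then there exists a constant $C>0$ depending on $c$ and $d$ such that $$\inf_{\tilde v\in\mathcal{F}}\ \sup_{\theta^*,v^*\in K,\ v_i^*\in(\frac{c^2}{8},\frac{3c^2}{8})\,\forall i}\ \mathbb{E}\left(\frac1n\|\tilde v(y)-v^*\|^2\right)\ge\frac{C}{n^{1/d}},$$ for data generated as $y_i=\theta_i^*+\sqrt{v_i^*}\,\epsilon_i$ with $\epsilon_1,\ldots,\epsilon_n$ independent $N(0,1)$, $i=1,\ldots,n$.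
   Context: The $d$-dimensional grid graph of size $n=m^d$ has node set $\{1,\ldots,m\}^d$ (identified with $\{1,\ldots,n\}$), with $i,j$ connected if and only if $\|i-j\|_1=1$. $\nabla_G$ is its edge incidence matrix, so $\|\nabla_G\theta\|_1=\sum_{(i,j)\in E}|\theta_i-\theta_j|$, each undirected edge counted once. $\|\cdot\|$ is the Euclidean norm, $\|\cdot\|_\infty$ the maximum norm. The constant $C$ does not depend on $n$. *)

(* Defs.v *)
From HB Require Import structures.
From mathcomp Require Import all_boot all_order all_algebra.
From mathcomp Require Import all_classical all_reals all_analysis.

Set Implicit Arguments.
Unset Strict Implicit.
Unset Printing Implicit Defensive.

Import Order.TTheory GRing.Theory Num.Theory.

Local Open Scope classical_set_scope.
Local Open Scope ring_scope.

Section norms.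
Context {R : realType} {n : nat}.
Implicit Type x : n.-tuple R.

Definition euclid_norm x : R := Num.sqrt (\sum_(i < n) tnth x i ^+ 2).

Definition max_norm x : R := \big[Num.max/0]_(i < n) `|tnth x i|.

Definition tuple_sub (x y : n.-tuple R) : n.-tuple R :=
  [tuple tnth x i - tnth y i | i < n].

End norms.

Section grid.
Variables d m : nat.

Lemma card_grid_node : (m ^ d)%N = #|{: {ffun 'I_d -> 'I_m}}|.
Proof. by rewrite card_ffun !card_ord. Qed.

(* Vectors are indexed by 'I_(m ^ d), identified with the node set
   {0, ..., m - 1}^d by an arbitrary fixed bijection. *)
Definition grid_node (i : 'I_(m ^ d)) : {ffun 'I_d -> 'I_m} :=
  enum_val (cast_ord card_grid_node i).

Definition grid_adj : rel 'I_(m ^ d) := fun i j =>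
  (\sum_(k < d) `|(grid_node i k)%:Z - (grid_node j k)%:Z|%N == 1)%N.

(* The l1 norm of the edge differences; the condition i < j makes each
   undirected edge count once. *)
Definition grid_tv {R : realType} (theta : (m ^ d).-tuple R) : R :=
  \sum_(i < m ^ d) \sum_(j < m ^ d | (i < j)%N && grid_adj i j)
    `|tnth theta i - tnth theta j|.

Definition bounded_tv_class {R : realType} (c : R) : set ((m ^ d).-tuple R) :=
  [set theta |
    grid_tv theta <= c * (m ^ d)%:R `^ (1 - d%:R^-1) /\ max_norm theta <= c].

End grid.
Arguments bounded_tv_class d m {R} c _.

Section model.
Context {disp : measure_display} {Omega : measurableType disp} {R : realType}.
Context {P : probability Omega R} {n : nat}.

Definition mutually_independent (X : 'I_n -> {RV P >-> R}) : Prop :=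
  forall (J : {set 'I_n}) (B : 'I_n -> set R),
    (forall i, measurable (B i)) ->
    P (\bigcap_(i in [set` J]) X i @^-1` B i) =
    (\prod_(i in J) P (X i @^-1` B i))%E.

(* The second parameter of normal_prob is the standard deviation. *)
Definition standard_normal (X : {RV P >-> R}) : Prop :=
  forall B : set R, measurable B -> distribution P X B = normal_prob 0 1 B.

Definition observation (eps : 'I_n -> {RV P >-> R}) (theta v : n.-tuple R)
    (w : Omega) : n.-tuple R :=
  [tuple tnth theta i + Num.sqrt (tnth v i) * eps i w | i < n].

Definition mse_risk (eps : 'I_n -> {RV P >-> R})
    (vt : n.-tuple R -> n.-tuple R) (theta v : n.-tuple R) : \bar R :=
  'E_P[fun w => n%:R^-1 *
    euclid_norm (tuple_sub (vt (observation eps theta v w)) v) ^+ 2].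

End model.

(* n.-tuple R carries the product of the Borel sigma-algebras of R. *)
Definition estimators (R : realType) (n : nat) :
    set (n.-tuple R -> n.-tuple R) :=
  [set vt | measurable_fun [set: n.-tuple R] vt].

Definition parameter_pairs (R : realType) (d m : nat) (c : R) :
    set ((m ^ d).-tuple R * (m ^ d).-tuple R) :=
  [set p | [/\ bounded_tv_class d m c p.1, bounded_tv_class d m c p.2 &
    forall i, c ^+ 2 / 8 < tnth p.2 i < 3 * c ^+ 2 / 8]].

Arguments estimators : clear implicits.
Arguments parameter_pairs {R} d m c _.

(* Main.v *)
(* Take theta = 0 and let v vary over a hypercube: v is the constant c^2/4,
   raised by a fixed b at an arbitrary subset of the face {first coordinate = 0}.
   The face has m^(d-1) nodes of degree at most 3^d, so a small b of order c^2
   keeps v in the total variation ball whatever the subset.  Raising one variance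
   from a to a + b multiplies the law of the observation by a density bounded
   below by sqrt(a/(a+b)), since the exponential factor of the Gaussian density
   only increases.  Hence no estimator can tell the two values at a face node
   apart, each face node contributes a constant to the risk averaged over the
   hypercube, and the average risk is of order m^(d-1)/m^d = n^(-1/d). *)
From HB Require Import structures.
Require Import Defs.
From mathcomp Require Import all_boot all_order all_algebra.
From mathcomp Require Import all_classical all_reals all_analysis.
From mathcomp Require Import measurable_realfun.
From mathcomp Require Import ring lra zify.

Set Implicit Arguments.
Unset Strict Implicit.
Unset Printing Implicit Defensive.

Import Order.TTheory GRing.Theory Num.Theory.

Local Open Scope classical_set_scope.
Local Open Scope ring_scope.

(** * Scaling of Lebesgue measure and of the standard normal law *)

Section scale_measure.
Context {R : realType} (r : R).
Hypothesis r_gt0 : 0 < r.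

Let scale : measurableTypeR R -> measurableTypeR R := *%R r.

Let measurable_scale : measurable_fun [set: measurableTypeR R] scale.
Proof. exact: measurable_funM. Qed.

HB.instance Definition _ :=
  isMeasurableFun.Build _ _ _ _ scale measurable_scale.

(** By uniqueness of Lebesgue measure: [r] times the pushforward under scaling gives every interval
    []a, b]] its length. *)
Lemma lebesgue_measure_scale (B : set R) : measurable B ->
  (lebesgue_measure ( *%R r @^-1` B) = r^-1%:E * lebesgue_measure B)%E.
Proof.
move=> mB.
pose rn : {nonneg R} := NngNum (ltW r_gt0).
rewrite [in RHS](@lebesgue_measure_unique R
    (mscale rn (pushforward lebesgue_measure scale)))//; last first.
  move=> _ [[a b] /= ab <-]; rewrite /mscale/= /pushforward/=.
  have -> : scale @^-1` `]a, b] = `]a / r, b / r]%classic.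
    apply/seteqP; split => x /=; rewrite !in_itv/= ltr_pdivrMr// ler_pdivlMr//;
      by rewrite /scale mulrC.
  rewrite !lebesgue_measure_itv/= !lte_fin ltr_pM2r ?invr_gt0//.
  case: ifPn => _; last by rewrite mule0.
  by rewrite -!EFinB -EFinM; congr EFin; field; rewrite gt_eqF.
by rewrite /mscale/= /pushforward/= muleA -EFinM mulVf ?mul1e// gt_eqF.
Qed.

(** With Z standard normal, the right side is the law of [r] Z, whose density at x is [r^-1] times
    the standard one at x / r. For [1 <= r] that point is closer to 0, where the standard density is
    larger. *)
Lemma normal_prob_scale_ge (B : set R) : 1 <= r -> measurable B ->
  (r^-1%:E * normal_prob 0 1 B <= normal_prob 0 1 ( *%R r @^-1` B))%E.
Proof.
move=> r1 mB.
have ri0 : 0 <= r^-1 by rewrite invr_ge0 ltW.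
have mpdf (k : R) : measurable_fun B (fun x : R => (normal_pdf 0 1 (k * x))%:E).
  apply/measurable_EFinP; apply: measurable_funTS.
  by apply: measurableT_comp; [exact: measurable_normal_pdf|exact: measurable_funM].
(* The integrand is written in the image variable, so that the scaling affects only the measure,
   which then becomes [r^-1] times Lebesgue. *)
have -> : (normal_prob 0 1 ( *%R r @^-1` B) =
    \int[pushforward lebesgue_measure scale]_(x in B) (normal_pdf 0 1 (r^-1 * x))%:E)%E.
  rewrite ge0_integral_pushforward//=; last 2 first.
    exact: mpdf.
    by move=> x _; rewrite lee_fin normal_pdf_ge0.
  by apply: eq_integral => x _ /=; rewrite mulrA mulVf ?mul1r// gt_eqF.
pose rn : {nonneg R} := NngNum ri0.
rewrite (eq_measure_integral (mscale rn lebesgue_measure)); last first.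
  by move=> A mA _; exact: lebesgue_measure_scale.
rewrite ge0_integral_mscale//; last 2 first.
- exact: mpdf.
- by move=> x _; rewrite lee_fin normal_pdf_ge0.
rewrite lee_wpmul2l ?lee_fin// /normal_prob ge0_le_integral//=.
- by move=> x _; rewrite lee_fin normal_pdf_ge0.
- by apply/measurable_EFinP; apply: measurable_funTS; exact: measurable_normal_pdf.
- exact: mpdf.
- move=> x _; rewrite lee_fin !normal_pdfE ?oner_neq0//.
  rewrite ler_wpM2l ?normal_peak_ge0// /normal_fun ler_expR !subr0.
  rewrite !mulNr lerN2 ler_pM2r; last by rewrite invr_gt0 expr1n; lra.
  rewrite exprMn ler_piMl ?sqr_ge0// exprn_ile1 ?invf_le1//.
Qed.

End scale_measure.

(** * Boxes as a generating pi-system for laws of tuples *)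

Section tuple_law.
Context {R : realType} {n : nat}.

Definition box (B : 'I_n -> set R) : set (n.-tuple R) :=
  [set x | forall k, B k (tnth x k)].

Definition boxes : set (set (n.-tuple R)) :=
  [set A | exists2 B, (forall k, measurable (B k)) & A = box B].

Lemma measurable_boxes : @measurable _ (n.-tuple R) = <<s boxes >>.
Proof.
apply/seteqP; split.
  apply: smallest_sub; first exact: smallest_sigma_algebra.
  rewrite -bigcup_seq; apply: bigcup_sub => i _ _ [C mC <-].
  apply: sub_sigma_algebra.
  exists (fun k => if k == i then C else setT) => [k|].
    by case: ifP => // _; exact: measurableT.
  rewrite setTI; apply/seteqP; split => x /=.
    by move=> Cx k; case: eqP => // ->.
  by move=> /(_ i); rewrite eqxx.
apply: smallest_sub; first exact: sigma_algebra_measurable.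
move=> _ [B mB ->].
have -> : box B = \bigcap_(k in [set: 'I_n]) ((@tnth n R)^~ k @^-1` B k).
  by apply/seteqP; split => x Bx k //=; exact: Bx.
apply: fin_bigcap_measurable => // k _.
by rewrite -[X in measurable X]setTI; exact: measurable_tnth.
Qed.

Lemma boxesI : setI_closed boxes.
Proof.
move=> _ _ [B mB ->] [C mC ->]; exists (fun k => B k `&` C k).
  by move=> k; exact: measurableI.
apply/seteqP; split => x /= => [[Bx Cx] k|BCx]; first by split.
by split=> k; have [] := BCx k.
Qed.

(** Boxes are stable under intersection and generate the product sigma-algebra; finiteness of [m1]
    lets the constant sequence [setT] serve as the exhausting cover. *)
Lemma eq_measure_boxes (m1 m2 : {measure set (n.-tuple R) -> \bar R}) :
  (m1 setT < +oo)%E ->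
  (forall B, (forall k, measurable (B k)) -> m1 (box B) = m2 (box B)) ->
  forall A, measurable A -> m1 A = m2 A.
Proof.
move=> m1oo m12; have boxT : box (fun=> setT) = setT by apply/seteqP; split.
apply: (measure_unique boxes (fun=> setT)) => //.
- exact: measurable_boxes.
- exact: boxesI.
- by move=> _; exists (fun=> setT) => // k; exact: measurableT.
- by apply/seteqP; split => // x _; exists 0%N.
- by move=> _ [B mB ->]; exact: m12.
Qed.

(* Through this map the law of a tuple of independent entries becomes a product
   of only two factors, so that one entry's law can be changed by Fubini. *)
Definition tuple_set (i : 'I_n) (p : R * n.-tuple R) : n.-tuple R :=
  [tuple if k == i then p.1 else tnth p.2 k | k < n].

Lemma measurable_tuple_set i : measurable_fun [set: R * n.-tuple R] (tuple_set i).
Proof.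
apply/measurable_fun_tnthP => k.
have [->|ki] := eqVneq k i.
  rewrite (_ : _ \o _ = fst)//.
  by apply/funext => p /=; rewrite tnth_mktuple eqxx.
rewrite (_ : _ \o _ = (@tnth n R)^~ k \o snd).
  by apply: measurableT_comp => //; exact: measurable_tnth.
by apply/funext => p /=; rewrite tnth_mktuple (negbTE ki).
Qed.

End tuple_law.

(** * Changing the law of a single entry *)

Section resampling.
Context {R : realType} {n : nat} {disp : measure_display}.
Context {Omega : measurableType disp} (P : probability Omega R).
Implicit Types X Y : {mfun Omega >-> n.-tuple R}.

Definition entry (X : Omega -> n.-tuple R) k (w : Omega) : R := tnth (X w) k.

Lemma measurable_entry X k : measurable_fun [set: Omega] (entry X k).
Proof.
by apply: (@measurableT_comp _ _ _ _ _ _ ((@tnth n R)^~ k)) => //;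
  exact: measurable_tnth.
Qed.

HB.instance Definition _ X k :=
  isMeasurableFun.Build _ _ _ _ (entry X k) (measurable_entry X k).

(** Full boxes suffice: subfamilies of entries are covered by taking [setT] in the other factors. *)
Definition independent_entries (X : Omega -> n.-tuple R) :=
  forall B : 'I_n -> set R, (forall k, measurable (B k)) ->
  P (X @^-1` box B) = (\prod_k P (entry X k @^-1` B k))%E.

(** On a box both sides factor over the entries. The entry [i] of [X] is overwritten by an
    independent draw from the law of entry [i] of [Y], and the remaining factors agree by
    assumption. *)
Lemma law_tuple_set X Y i : independent_entries X -> independent_entries Y ->
  (forall k B, k != i -> measurable B ->
    P (entry X k @^-1` B) = P (entry Y k @^-1` B)) ->
  forall A, measurable A ->
  P (Y @^-1` A) =
  (distribution P (entry Y i) \x^ distribution P X)%E (tuple_set i @^-1` A).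
Proof.
move=> indX indY XY A mA.
pose ts : {mfun (R * n.-tuple R)%type >-> n.-tuple R} :=
  HB.pack (tuple_set i : (R * n.-tuple R)%type -> n.-tuple R)
    (isMeasurableFun.Build _ _ _ _ _ (measurable_tuple_set i)).
apply: (@eq_measure_boxes _ _ (distribution P Y)
  (pushforward (distribution P (entry Y i) \x^ distribution P X)%E ts)) => //.
  exact: le_lt_trans (probability_le1 _ measurableT) (ltry _).
move=> B mB; transitivity (P (Y @^-1` box B)) => //; rewrite indY//.
transitivity ((distribution P (entry Y i) \x^ distribution P X)%E
  (tuple_set i @^-1` box B)) => //.
(* The overwritten entry of [X] is unconstrained, so its factor is the total mass 1. *)
pose B' k := if k == i then setT else B k.
have -> : tuple_set i @^-1` box B = B i `*` box B'.
  apply/seteqP; split => [[x t]/= Bxt|[x t]/= [Bx Bt] k].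
    split; first by have := Bxt i; rewrite tnth_mktuple eqxx.
    move=> k; rewrite /B'; case: eqP => // /eqP ki.
    by have := Bxt k; rewrite tnth_mktuple (negbTE ki).
  rewrite tnth_mktuple; have [->//|ki] := eqVneq k i.
  by have := Bt k; rewrite /B' (negbTE ki).
have mB' k : measurable (B' k) by rewrite /B'; case: ifP.
rewrite product_measure2E//; last first.
  by rewrite measurable_boxes; apply: sub_sigma_algebra; exists B'.
rewrite [X in (_ * X)%E]indX// (bigD1 i)//= [in RHS](bigD1 i)//= {1}/B' eqxx preimage_setT.
rewrite probability_setT mul1e; congr (_ * _)%E.
by apply: eq_bigr => k ki; rewrite /B' (negbTE ki) XY.
Qed.

(** Both laws are integrals, against the same law of [X], of the mass that the entry [i] gives to a
    section; the bound for one entry holds section by section. *)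
Lemma le_law_entry X Y i (q : {nonneg R}) :
  independent_entries X -> independent_entries Y ->
  (forall k B, k != i -> measurable B ->
    P (entry X k @^-1` B) = P (entry Y k @^-1` B)) ->
  (forall B, measurable B ->
    (q%:num%:E * P (entry X i @^-1` B) <= P (entry Y i @^-1` B))%E) ->
  forall A, measurable A ->
  (q%:num%:E * P (X @^-1` A) <= P (Y @^-1` A))%E.
Proof.
move=> indX indY XY qXY A mA.
have mtA : measurable (tuple_set i @^-1` A).
  by rewrite -[X in measurable X]setTI; exact: measurable_tuple_set.
(* [X] itself is also represented this way: redrawing its entry [i] from its own law changes
   nothing. *)
rewrite (@law_tuple_set X X i)// (@law_tuple_set X Y i)// /product_measure2.
have mys (Z : {mfun Omega >-> n.-tuple R}) : measurable_fun [set: n.-tuple R]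
    (distribution P (entry Z i) \o ysection (tuple_set i @^-1` A)).
  by apply: measurable_fun_ysection.
rewrite -ge0_integralZl//=.
apply: ge0_le_integral => //=.
- by move=> t _; rewrite mule_ge0 ?lee_fin.
- by apply: emeasurable_funM => //; exact: mys.
- exact: mys.
- by move=> t _; apply: qXY; exact: measurable_ysection.
Qed.

Lemma le_integral_entry X Y i (q : {nonneg R}) :
  independent_entries X -> independent_entries Y ->
  (forall k B, k != i -> measurable B ->
    P (entry X k @^-1` B) = P (entry Y k @^-1` B)) ->
  (forall B, measurable B ->
    (q%:num%:E * P (entry X i @^-1` B) <= P (entry Y i @^-1` B))%E) ->
  forall f : n.-tuple R -> \bar R, measurable_fun [set: n.-tuple R] f ->
  (forall t, 0 <= f t)%E ->
  (q%:num%:E * \int[P]_w f (X w) <= \int[P]_w f (Y w))%E.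
Proof.
move=> indX indY XY qXY f mf f0.
rewrite -(ge0_integral_distribution (P := P) X)// -(ge0_integral_distribution (P := P) Y)//.
rewrite -ge0_integral_mscale//.
apply: ge0_le_measure_integral => //= A mA.
by rewrite /mscale/=; exact: le_law_entry qXY _ mA.
Qed.

End resampling.

(** * Gaussian observations and the two-point bound *)

Section gaussian_observation.
Context {R : realType} {n : nat} {disp : measure_display}.
Context {Omega : measurableType disp} {P : probability Omega R}.
Variable eps : 'I_n -> {RV P >-> R}.
Hypothesis eps_indep : mutually_independent eps.
Hypothesis eps_normal : forall i, standard_normal (eps i).
Implicit Types theta v : n.-tuple R.

Lemma measurable_affine (x y : R) : measurable_fun [set: R] (fun z => x + y * z).
Proof. by apply: measurable_funD => //; exact: measurable_funM. Qed.

Lemma measurable_observation theta v :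
  measurable_fun [set: Omega] (observation eps theta v).
Proof.
apply/measurable_fun_tnthP => k.
rewrite (_ : _ \o _ = (fun x => tnth theta k + Num.sqrt (tnth v k) * x) \o eps k).
  by apply: measurableT_comp => //; exact: measurable_affine.
by apply/funext => w /=; rewrite tnth_mktuple.
Qed.

HB.instance Definition _ theta v :=
  isMeasurableFun.Build _ _ _ _ (observation eps theta v)
    (measurable_observation theta v).

Lemma preimage_entry_observation theta v k (B : set R) :
  entry (observation eps theta v) k @^-1` B =
  eps k @^-1` [set x | B (tnth theta k + Num.sqrt (tnth v k) * x)].
Proof. by apply/seteqP; split => w; rewrite /= /entry tnth_mktuple. Qed.

Lemma measurable_affine_preimage (x y : R) (B : set R) :
  measurable B -> measurable [set z | B (x + y * z)].
Proof.
by move=> mB; rewrite -[X in measurable X]setTI; exact: measurable_affine.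
Qed.

Lemma independent_observation theta v :
  independent_entries P (observation eps theta v).
Proof.
move=> B mB.
have := eps_indep [set: 'I_n]%SET
  (fun k => measurable_affine_preimage (tnth theta k) (Num.sqrt (tnth v k)) (mB k)).
rewrite (eq_bigl xpredT) => [E|k]; last by rewrite inE.
transitivity (\prod_k P (eps k @^-1`
  [set x | B k (tnth theta k + Num.sqrt (tnth v k) * x)%R]))%E; last first.
  by apply: eq_bigr => k _; rewrite preimage_entry_observation.
rewrite -E; congr (P _); apply/seteqP; split => w /= Bw k.
  by move=> _ /=; have := Bw k; rewrite tnth_mktuple.
by rewrite tnth_mktuple; apply: Bw => /=; rewrite inE.
Qed.

Lemma le_integral_observation theta v v' i (f : n.-tuple R -> \bar R) :
  (forall k, k != i -> tnth v k = tnth v' k) ->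
  0 < tnth v i <= tnth v' i ->
  measurable_fun [set: n.-tuple R] f -> (forall t, 0 <= f t)%E ->
  ((Num.sqrt (tnth v i / tnth v' i))%:E *
     \int[P]_w f (observation eps theta v w) <=
   \int[P]_w f (observation eps theta v' w))%E.
Proof.
move=> vv' /andP[vi0 vi] mf f0.
have v'i0 : 0 < tnth v' i by exact: lt_le_trans vi.
pose q : {nonneg R} := NngNum (sqrtr_ge0 (tnth v i / tnth v' i)).
apply: (@le_integral_entry _ _ _ _ P
  (observation eps theta v)
  (observation eps theta v') i q) => //.
- exact: independent_observation.
- exact: independent_observation.
- by move=> k B ki mB; rewrite !preimage_entry_observation vv'.
move=> B mB; rewrite !preimage_entry_observation.
(* [r] is the ratio of the two standard deviations: the noise event for [v'] is the one for [v]
   pulled back along scaling by [r]. *)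
pose r := Num.sqrt (tnth v' i) / Num.sqrt (tnth v i).
have r1 : 1 <= r by rewrite ler_pdivlMr ?sqrtr_gt0// mul1r ler_wsqrtr.
have r0 : 0 < r by exact: lt_le_trans r1.
have mC := measurable_affine_preimage (tnth theta i) (Num.sqrt (tnth v i)) mB.
set C := [set x | _] in mC *.
have -> : [set x | B (tnth theta i + Num.sqrt (tnth v' i) * x)] = *%R r @^-1` C.
  apply/seteqP; split => x /=; rewrite /C /= mulrA [_ * r]mulrC divfK//;
    by rewrite gt_eqF// sqrtr_gt0.
have -> : q%:num = r^-1 by rewrite /q/= sqrtrM ?(ltW vi0)// sqrtrV ?(ltW v'i0)// invf_div.
have lawE D : measurable D -> P (eps i @^-1` D) = normal_prob 0 1 D.
  exact: eps_normal.
rewrite !lawE//; first exact: normal_prob_scale_ge.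
by rewrite -[X in measurable X]setTI; exact: mulrl_measurable.
Qed.

(** Le Cam's two-point argument: the second risk is moved to the law under [v] at the price of the
    factor [q]; under one common law, no number is close to both variances. *)
Lemma two_point_risk_ge theta v v' i (g : n.-tuple R -> R) :
  (forall k, k != i -> tnth v k = tnth v' k) ->
  0 < tnth v i <= tnth v' i ->
  measurable_fun [set: n.-tuple R] g ->
  ((Num.sqrt (tnth v i / tnth v' i) * ((tnth v' i - tnth v i) ^+ 2 / 2))%:E <=
   \int[P]_w ((g (observation eps theta v w) - tnth v i) ^+ 2)%:E +
   \int[P]_w ((g (observation eps theta v' w) - tnth v' i) ^+ 2)%:E)%E.
Proof.
move=> vv' vi mg; set q := Num.sqrt _.
have q0 : 0 <= q by exact: sqrtr_ge0.
have q1 : q <= 1.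
  by rewrite -sqrtr1 ler_wsqrtr// ler_pdivrMr ?mul1r; lra.
have msq (x : R) : measurable_fun [set: n.-tuple R] (fun t => ((g t - x) ^+ 2)%:E).
  by apply/measurable_EFinP; apply: measurable_funX; exact: measurable_funB.
have mo (x : R) : measurable_fun [set: Omega]
    (fun w => ((g (observation eps theta v w) - x) ^+ 2)%:E).
  exact: measurableT_comp (msq x) (measurable_observation theta v).
have ge0 u (x : R) :
    (0 <= \int[P]_w ((g (observation eps theta u w) - x) ^+ 2)%:E)%E.
  by apply: integral_ge0 => w _; rewrite lee_fin sqr_ge0.
have := le_integral_observation theta vv' vi (msq (tnth v' i))
  (fun t => sqr_ge0 (g t - tnth v' i)).
move=> /(leeD (lexx (\int[P]_w ((g (observation eps theta v w) - tnth v i) ^+ 2)%:E)))%E.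
apply: le_trans; rewrite -/q.
(* As [q <= 1], the first risk may carry the factor [q] too, and the two integrals merge. *)
apply: (@le_trans _ _ (q%:E *
  \int[P]_w ((g (observation eps theta v w) - tnth v i) ^+ 2)%:E + q%:E *
  \int[P]_w ((g (observation eps theta v w) - tnth v' i) ^+ 2)%:E)%E); last first.
  by rewrite leeD2r// -[leRHS]mul1e lee_wpmul2r// lee_fin.
rewrite -ge0_muleDr// -ge0_integralD//; last 2 first.
- by move=> w _; rewrite lee_fin sqr_ge0.
- by move=> w _; rewrite lee_fin sqr_ge0.
rewrite EFinM lee_wpmul2l ?lee_fin//.
rewrite -[leLHS]mule1 -(@probability_setT _ _ _ P) -integral_cst//.
apply: ge0_le_integral => //=.
- by move=> w _; rewrite lee_fin mulr_ge0 ?sqr_ge0// invr_ge0.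
- by apply: emeasurable_funD; exact: mo.
move=> w _; rewrite lee_fin.
set x := g _; set y := tnth v i; set z := tnth v' i.
(* (x - y)^2 + (x - z)^2 is the half sum of (2x - y - z)^2 and (z - y)^2. *)
by have := sqr_ge0 (2 * x - y - z); lra.
Qed.

Lemma mse_riskE vt theta v : estimators R n vt ->
  mse_risk eps vt theta v = (n%:R^-1%:E *
    \sum_k \int[P]_w ((tnth (vt (observation eps theta v w)) k - tnth v k) ^+ 2)%:E)%E.
Proof.
move=> mvt; rewrite /mse_risk unlock.
have mo k : measurable_fun [set: Omega]
    (fun w => ((tnth (vt (observation eps theta v w)) k - tnth v k) ^+ 2)%:E).
  apply/measurable_EFinP; apply: measurable_funX; apply: measurable_funB => //.
  exact: measurableT_comp (measurable_tnth k)
    (measurableT_comp mvt (measurable_observation theta v)).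
rewrite -ge0_integral_sum//; last by move=> k w _; rewrite lee_fin sqr_ge0.
rewrite -ge0_integralZl_EFin//; last 2 first.
- by move=> w _; apply: sume_ge0 => k _; rewrite lee_fin sqr_ge0.
- by apply: emeasurable_sum => k; exact: mo.
apply: eq_integral => w _; rewrite sumEFin -EFinM /euclid_norm sqr_sqrtr; last first.
  by apply: sumr_ge0 => k _; rewrite sqr_ge0.
by congr ((_ * _)%:E); apply: eq_bigr => k _; rewrite tnth_mktuple.
Qed.

End gaussian_observation.

(** * Averaging over the hypercube (Assouad's method) *)

Section assouad.
Context {R : realType} {n : nat} {disp : measure_display}.
Context {Omega : measurableType disp} {P : probability Omega R}.
Variable eps : 'I_n -> {RV P >-> R}.
Hypothesis eps_indep : mutually_independent eps.
Hypothesis eps_normal : forall i, standard_normal (eps i).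
Variables (a b : R).
Hypotheses (a_gt0 : 0 < a) (b_gt0 : 0 < b).

Definition hypercube_vertex (T : {set 'I_n}) : n.-tuple R :=
  [tuple a + b * (k \in T)%:R | k < n].

Let flip (k : 'I_n) (T : {set 'I_n}) : {set 'I_n} :=
  if k \in T then T :\ k else k |: T.

Let flipK k : involutive (flip k).
Proof.
move=> T; have [kT|kT] := boolP (k \in T); rewrite /flip.
  by rewrite kT setD11 finset.setD1K.
by rewrite (negbTE kT) setU11 finset.setU1K.
Qed.

Definition coordinate_risk (vt : n.-tuple R -> n.-tuple R) theta v (k : 'I_n) : \bar R :=
  (\int[P]_w ((tnth (vt (observation eps theta v w)) k - tnth v k) ^+ 2)%:E)%E.

Lemma coordinate_risk_ge0 vt theta v k : (0 <= coordinate_risk vt theta v k)%E.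
Proof. by apply: integral_ge0 => w _; rewrite lee_fin sqr_ge0. Qed.

Let q := Num.sqrt (a / (a + b)) * (b ^+ 2 / 2).

Lemma coordinate_risk_flip vt theta k (T : {set 'I_n}) : estimators R n vt ->
  (q%:E <= coordinate_risk vt theta (hypercube_vertex T) k +
    coordinate_risk vt theta (hypercube_vertex (flip k T)) k)%E.
Proof.
move=> mvt.
(* The claim is symmetric under [flip k], and the two-point bound wants the smaller variance
   first. *)
wlog kT : T / k \notin T.
  move=> H; have [kT|/H//] := boolP (k \in T).
  have := H (flip k T); rewrite flipK addeC; apply.
  by rewrite /flip kT setD11.
rewrite /flip (negbTE kT).
have -> : q = Num.sqrt (tnth (hypercube_vertex T) k / tnth (hypercube_vertex (k |: T)) k)
    * ((tnth (hypercube_vertex (k |: T)) k - tnth (hypercube_vertex T) k) ^+ 2 / 2).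
  by rewrite !tnth_mktuple setU11 (negbTE kT)/= mulr0 mulr1 addr0 addrAC subrr add0r.
apply: (@two_point_risk_ge _ _ _ _ _ _ eps_indep eps_normal theta _ _ k
  (fun y => tnth (vt y) k)).
- move=> j jk; rewrite !tnth_mktuple !inE (negbTE jk)//.
- by rewrite !tnth_mktuple setU11 (negbTE kT)/= mulr0 mulr1 addr0 a_gt0 lerDl ltW.
exact: measurableT_comp (measurable_tnth k) mvt.
Qed.

(** Pairing each [T] with [flip k T] gives at least [q] per pair, and there are half as many pairs
    as subsets. Summing over all [T] and intersecting with [S] keeps the index set a full power
    set. *)
Lemma sum_coordinate_risk_ge vt theta (S : {set 'I_n}) k :
  estimators R n vt -> k \in S ->
  ((2 ^+ n * (q / 2))%:E <=
   \sum_(T : {set 'I_n}) coordinate_risk vt theta (hypercube_vertex (T :&: S)) k)%E.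
Proof.
move=> mvt kS; set F := fun T => coordinate_risk vt theta (hypercube_vertex (T :&: S)) k.
have flipI T : flip k T :&: S = flip k (T :&: S).
  rewrite /flip inE kS andbT; case: ifP => _; apply/finset.setP => j; rewrite !inE.
    by rewrite andbA.
  by case: eqP => // ->; rewrite kS.
have : (\sum_(T : {set 'I_n}) q%:E <= \sum_T F T + \sum_T F T)%E.
  rewrite [X in (_ + X)%E](reindex_inj (inv_inj (flipK k))) -big_split/=.
  by apply: lee_sum => T _; rewrite /F flipI; exact: coordinate_risk_flip.
rewrite sumEFin sumr_const -cardsT -powersetT card_powerset cardsT card_ord.
(* The doubled sum can be halved only when it is finite; the infinite cases are settled directly. *)
case: (\sum_T F T)%E => [x| |].
- by rewrite -EFinD !lee_fin -[q *+ _]mulr_natl natrX; lra.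
- by move=> _; rewrite leey.
- by [].
Qed.

(** A bound on every vertex bounds the average over the [2 ^+ n] subsets. After exchanging the sums,
    each coordinate in [S] contributes at least [q / 2] to the average, and the others are
    nonnegative. *)
Lemma assouad_risk_ge vt theta (S : {set 'I_n}) (M : \bar R) :
  estimators R n vt ->
  (forall T, mse_risk eps vt theta (hypercube_vertex (T :&: S)) <= M)%E ->
  ((n%:R^-1 * #|S|%:R * (q / 2))%:E <= M)%E.
Proof.
move=> mvt riskM.
case: M riskM => [x riskM| |riskM]; last 2 first.
- by rewrite leey.
- have := riskM finset.set0; rewrite (mse_riskE _ _ _ mvt) leeNy_eq => /eqP E.
  have : (0 <= -oo :> \bar R)%E; last by [].
  by rewrite -E mule_ge0 ?lee_fin// ?invr_ge0// sume_ge0// => k _;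
    exact: coordinate_risk_ge0.
have : (\sum_(T : {set 'I_n}) mse_risk eps vt theta (hypercube_vertex (T :&: S)) <=
    \sum_(T : {set 'I_n}) x%:E)%E by apply: lee_sum.
rewrite sumEFin sumr_const -cardsT -powersetT card_powerset cardsT card_ord.
suff /le_trans/[apply] : ((2 ^+ n * (n%:R^-1 * #|S|%:R * (q / 2)))%:E <=
  \sum_(T : {set 'I_n}) mse_risk eps vt theta (hypercube_vertex (T :&: S)))%E.
  by rewrite !lee_fin -[x *+ _]mulr_natl natrX ler_pM2l// exprn_gt0.
under eq_bigr do rewrite (mse_riskE _ _ _ mvt).
rewrite -ge0_sume_distrr; last first.
  by move=> T _; apply: sume_ge0 => k _; exact: coordinate_risk_ge0.
rewrite (_ : 2 ^+ n * _ = n%:R^-1 * (#|S|%:R * (2 ^+ n * (q / 2)))); last by ring.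
rewrite EFinM lee_wpmul2l ?lee_fin ?invr_ge0// exchange_big/=.
apply: (@le_trans _ _ (\sum_(k in S) (2 ^+ n * (q / 2))%:E)%E).
  by rewrite sumEFin sumr_const mulr_natl.
rewrite big_mkcond; apply: lee_sum => k _; case: ifPn => kS.
  exact: sum_coordinate_risk_ge.
by apply: sume_ge0 => T _; exact: coordinate_risk_ge0.
Qed.

End assouad.

(** * Size of a face of the grid *)

Section grid_face.
Context {d m : nat}.

Definition grid_face : {set 'I_(m ^ d.+1)} :=
  [set i | (grid_node i ord0 == 0%N :> nat)].

Lemma grid_node_inj : injective (@grid_node d m).
Proof. by move=> i j /enum_val_inj /cast_ord_inj. Qed.

End grid_face.

(** [grid_node] maps the face bijectively onto a family of functions with one allowed value at
    [ord0] and [m] at each other coordinate. *)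
Lemma card_grid_face d m : (0 < m)%N -> #|@grid_face d m| = (m ^ d)%N.
Proof.
move=> m0.
pose F (k : 'I_d.+1) := [pred x : 'I_m | (k == ord0) ==> (x == 0%N :> nat)].
transitivity #|family F|.
  rewrite -(card_imset _ (@grid_node_inj d.+1 m)); apply: eq_card => f.
  apply/imsetP/familyP => [[i + ->] k|Ff].
    by rewrite !inE => /eqP i0; apply/implyP => /eqP ->; rewrite i0.
  exists (cast_ord (esym (card_grid_node d.+1 m)) (enum_rank f)); last first.
    by rewrite /grid_node cast_ordKV enum_rankK.
  by rewrite inE /grid_node cast_ordKV enum_rankK; have := Ff ord0; rewrite inE eqxx.
rewrite card_family foldrE big_map big_enum /= big_ord_recl.
rewrite (eq_card (B := pred1 (Ordinal m0))) ?card1 ?mul1n; last first.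
  by move=> x; rewrite !inE /=.
rewrite (eq_bigr (fun=> m)) ?prod_nat_const ?card_ord// => k _.
by rewrite (eq_card (B := predT)) ?card_ord// => x; rewrite !inE.
Qed.

(** * Node degrees and total variation *)

Section grid_degree.
Context {d m : nat}.
Implicit Types i j : 'I_(m ^ d).

Lemma grid_adj_sym : symmetric (@grid_adj d m).
Proof.
by move=> i j; rewrite /grid_adj; under eq_bigr do rewrite distnC.
Qed.

(** A neighbour differs by at most 1 in each coordinate, so it is determined by [d] steps with three
    values each. *)
Lemma grid_degree i : (#|grid_adj i| <= 3 ^ d)%N.
Proof.
(* Adding 1 before the truncated subtraction encodes the steps -1, 0, 1 as 0, 1, 2. *)
pose step (j : 'I_(m ^ d)) : {ffun 'I_d -> 'I_3} :=
  [ffun k => inord (grid_node j k + 1 - grid_node i k)].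
have le1 j k : grid_adj i j -> (`|(grid_node i k)%:Z - (grid_node j k)%:Z|%N <= 1)%N.
  by move=> /eqP <-; rewrite (bigD1 k)//= leq_addr.
have step_inj : {in grid_adj i &, injective step}.
  move=> j1 j2 ij1 ij2 /ffunP stepE; apply: (@grid_node_inj d m); apply/ffunP => k.
  have := stepE k; rewrite !ffunE => /(congr1 (@nat_of_ord 3)).
  have := le1 _ k ij1; have := le1 _ k ij2.
  move=> h2 h1; rewrite !inordK; try lia.
  by move=> h; apply/val_inj => /=; lia.
by rewrite -(card_in_imset step_inj) (leq_trans (max_card _))// card_ffun !card_ord.
Qed.

(** Each edge is charged to its endpoints in [A], and a node is charged at most once per neighbour.
    The factor 2 comes from bounding the lower and the upper endpoints separately. *)
Lemma grid_tv_le {R : realType} (b : R) (A : {set 'I_(m ^ d)}) (v : (m ^ d).-tuple R) :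
  0 <= b ->
  (forall i j, `|tnth v i - tnth v j| <= b * (i \in A)%:R + b * (j \in A)%:R) ->
  grid_tv v <= b * (2 * 3 ^ d * #|A|)%:R.
Proof.
move=> b0 vA; rewrite /grid_tv.
have H : \sum_i \sum_(j | grid_adj i j) b * (i \in A)%:R <= b * (3 ^ d * #|A|)%:R.
  rewrite natrM (_ : #|A|%:R = \sum_i (i \in A)%:R) ?mulrA ?mulr_sumr; last first.
    by rewrite -sum1_card natr_sum big_mkcond; apply: eq_bigr => i _; case: ifP.
  apply: ler_sum => i _; rewrite sumr_const.
  case: (i \in A) => /=; rewrite ?mulr0n ?mulr0 ?mul0rn// mulr1n !mulr1 -[leLHS]mulr_natr ler_wpM2l//.
  by rewrite ler_nat grid_degree.
have sub1 : \sum_(i < m ^ d) \sum_(j < m ^ d | (i < j)%N && grid_adj i j) b * (i \in A)%:R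
    <= \sum_i \sum_(j | grid_adj i j) b * (i \in A)%:R.
  apply: ler_sum => i _; rewrite big_mkcond [leRHS]big_mkcond; apply: ler_sum => j _.
  case: (grid_adj i j); rewrite ?andbF// andbT; case: ifP => // _.
  by rewrite mulr_ge0.
(* Exchanging the sums and using symmetry of adjacency puts the charged endpoint on the outside
   again. *)
have sub2 : \sum_(i < m ^ d) \sum_(j < m ^ d | (i < j)%N && grid_adj i j) b * (j \in A)%:R
    <= \sum_i \sum_(j | grid_adj i j) b * (i \in A)%:R.
  rewrite (exchange_big_dep predT)//=; apply: ler_sum => i _.
  rewrite big_mkcond [leRHS]big_mkcond; apply: ler_sum => j _.
  rewrite grid_adj_sym; case: (grid_adj i j); rewrite ?andbF// andbT; case: ifP => // _.
  by rewrite mulr_ge0.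
apply: (@le_trans _ _ (\sum_(i < m ^ d) \sum_(j < m ^ d | (i < j)%N && grid_adj i j)
    (b * (i \in A)%:R + b * (j \in A)%:R))).
  by apply: ler_sum => i _; apply: ler_sum => j _; exact: vA.
under eq_bigr do rewrite big_split/=.
rewrite big_split/= -mulnA natrM mulrCA mulr_natl mulr2n.
by apply: lerD; [exact: le_trans sub1 H|exact: le_trans sub2 H].
Qed.

End grid_degree.

(** * Choice of the hypercube and the minimax bound *)

Theorem lemma4 (R : realType) (d : nat) (c : R)
    (d_gt0 : (0 < d)%N) (c_itv : 0 < c < 1) :
  exists C : R, 0 < C /\
    forall m : nat, (0 < m)%N ->
    forall (disp : measure_display) (Omega : measurableType disp)
      (P : probability Omega R) (eps : 'I_(m ^ d) -> {RV P >-> R}),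
      mutually_independent eps ->
      (forall i, standard_normal (eps i)) ->
      ((C / (m ^ d)%:R `^ (d%:R^-1))%:E <=
       ereal_inf
         [set ereal_sup
            [set mse_risk eps vt p.1 p.2 | p in parameter_pairs d m c]
         | vt in estimators R (m ^ d)])%E.
Proof.
case: d d_gt0 => // d _; have /andP[c0 c1] := c_itv.
(* [a] is the midpoint of the allowed interval; [b] makes [2 * b * 3 ^ d.+1] equal to [c ^+ 2 / 4],
   which is below [c], and keeps [a + b] inside the interval. *)
pose a := c ^+ 2 / 4; pose b := c ^+ 2 / (8 * (3 ^ d.+1)%:R).
have c2 : 0 < c ^+ 2 by rewrite exprn_gt0.
have a0 : 0 < a by rewrite divr_gt0.
have pow3 : (3 : R) <= (3 ^ d.+1)%:R by rewrite ler_nat expnS leq_pmulr// expn_gt0.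
have b0 : 0 < b by rewrite divr_gt0// mulr_gt0//; lra.
have b3 : b * (3 ^ d.+1)%:R = c ^+ 2 / 8.
  by rewrite /b; field; apply/eqP; move: pow3; lra.
have b_lt : b < c ^+ 2 / 8 by rewrite -b3 ltr_pMr//; lra.
(* This is the two-point bound for the variances [a] and [a + b], halved by the pairing. *)
exists (Num.sqrt (a / (a + b)) * (b ^+ 2 / 2) / 2); split.
  by rewrite !divr_gt0// ?mulr_gt0 ?sqrtr_gt0 ?divr_gt0 ?exprn_gt0// addr_gt0.
move=> m m0 disp Omega P eps eps_indep eps_normal.
have mR0 : 0 < m%:R :> R by rewrite ltr0n.
have rootE : (m ^ d.+1)%:R `^ (d.+1%:R^-1) = m%:R :> R.
  by rewrite natrX -powR_mulrn ?ler0n// -powRrM divff ?pnatr_eq0// powRr1 ?ler0n.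
(* The total variation budget is thus [c] times the size of the face. *)
have surfaceE : (m ^ d.+1)%:R `^ (1 - d.+1%:R^-1) = (m ^ d)%:R :> R.
  rewrite powRD; last by rewrite pnatr_eq0 expn_eq0 -leqn0 leqNgt m0/= implybT.
  by rewrite powRr1 ?ler0n// powRN rootE expnS natrM mulrC mulKf ?gt_eqF.
apply: le_ereal_inf_tmp => _ [vt mvt <-].
(* Used with the empty set for [theta] and with a subset of the face for the variances. *)
have classP (v : (m ^ d.+1).-tuple R) (A : {set 'I_(m ^ d.+1)}) :
    (#|A| <= m ^ d)%N ->
    (forall i j, `|tnth v i - tnth v j| <= b * (i \in A)%:R + b * (j \in A)%:R) ->
    (forall i, `|tnth v i| <= c) -> bounded_tv_class d.+1 m c v.
  move=> leA vA vc; split; last first.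
    by apply: bigmax_le => [|i _]; [exact: ltW|exact: vc].
  rewrite surfaceE (le_trans (grid_tv_le (ltW b0) vA))//.
  rewrite natrM mulrA natrM mulrCA b3.
  apply: (@le_trans _ _ (2 * (c ^+ 2 / 8) * (m ^ d)%:R)).
    by rewrite ler_wpM2l ?ler_nat// mulr_ge0// divr_ge0// ltW.
  by rewrite ler_wpM2r// expr2; nra.
pose theta : (m ^ d.+1).-tuple R := [tuple 0 | i < _].
(* The face makes up a fraction 1/m of the nodes, which is the rate. *)
have -> : Num.sqrt (a / (a + b)) * (b ^+ 2 / 2) / 2 / (m ^ d.+1)%:R `^ d.+1%:R^-1 =
    (m ^ d.+1)%:R^-1 * #|@grid_face d m|%:R *
    (Num.sqrt (a / (a + b)) * (b ^+ 2 / 2) / 2).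
  rewrite rootE card_grid_face// expnS natrM; field.
  by rewrite !pnatr_eq0 -!lt0n expn_gt0 m0.
apply: (assouad_risk_ge eps_indep eps_normal a0 b0 (theta := theta) mvt) => T.
apply: ereal_sup_ubound; exists (theta, hypercube_vertex a b (T :&: grid_face)) => //.
have vE i : tnth (hypercube_vertex a b (T :&: @grid_face d m)) i =
  a + b * (i \in T :&: grid_face)%:R by rewrite tnth_mktuple.
have v_itv i : c ^+ 2 / 8 < tnth (hypercube_vertex a b (T :&: grid_face)) i
    < 3 * c ^+ 2 / 8.
  by rewrite vE /a; case: (i \in _); rewrite ?mulr0 ?mulr1; lra.
split => //=.
  apply: (@classP _ finset.set0) => [|i j|i]; first by rewrite cards0.
    by rewrite !tnth_mktuple subrr normr0 addr_ge0// mulr_ge0// ltW.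
  by rewrite tnth_mktuple normr0 ltW.
apply: (@classP _ (T :&: grid_face)) => [|i j|i].
- by rewrite -(card_grid_face d m0) subset_leq_card// subsetIr.
- rewrite !vE opprD addrACA subrr add0r (le_trans (ler_normB _ _))//.
  by rewrite !ger0_norm// mulr_ge0// ltW.
have /andP[v1 v2] := v_itv i.
by rewrite ger0_norm; [rewrite expr2 in v1 v2; nra|lra].
Qed.
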